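(* For every integer $m\ge 1$, $$\sum_{n=1}^\infty \frac{H_n^2}{n^{2m}}(-1)^{n-1} = -\zeta^\star(\overline{2m},2)-(2m+1)\zeta^\star(\overline{2m+1},1)-\zeta^\star(2m+1,1)-\zeta(2)\bar\zeta(2m)-2\sum_{l=2}^m \zeta^\star(2l-1,1)\,\bar\zeta(2m+2-2l),$$ and $$\begin{aligned}\sum_{n=1}^\infty \frac{H_nL_n(1)}{n^{2m}}(-1)^{n-1} &= \sum_{l=1}^{m-1}\zeta^\star(2l,1)\,\bar\zeta(2m+1-2l)-\ln 2\,\zeta^\star(\overline{2m},1)+\ln 2\,\zeta^\star(2m,1)+\frac12\zeta^\star(2m+1,1)\\ &\quad+\zeta^\star(\overline{2m},2)+\frac{2m-1}{2}\zeta^\star(\overline{2m+1},1)-\frac12\zeta(2)\bar\zeta(2m).\end{aligned}$$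
   Context: For integers $n,k\ge1$: $H_n=\sum_{j=1}^n \frac1j$, $L_n(k)=\sum_{j=1}^n \frac{(-1)^{j-1}}{j^k}$. $\zeta$ is the Riemann zeta function and $\bar\zeta(s)=\sum_{n=1}^\infty \frac{(-1)^{n-1}}{n^s}$ for $\Re(s)\ge 1$ (so $\bar\zeta(1)=\ln 2$). Multiple zeta-star values: for positive integers $s_1,\dots,s_k$, each possibly carrying a bar, $\zeta^\star(s_1,\dots,s_k)=\sum_{n_1\ge n_2\ge\cdots\ge n_k\ge1}\prod_{j=1}^k \frac{\varepsilon_j^{n_j}}{n_j^{s_j}}$, where $\varepsilon_j=-1$ if $s_j$ is barred and $\varepsilon_j=1$ otherwise; the series is read as the sum over $n_1$ of the finite inner sums. For instance $\zeta^\star(\bar q,p)=\sum_{m\ge1}\frac{(-1)^m}{m^q}\sum_{n=1}^m\frac1{n^p}$. Empty sums are zero. *)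

(* Defs.v *)
From Stdlib Require Import Reals List.
From Coquelicot Require Import Coquelicot.
Import ListNotations.
Open Scope R_scope.

(* [sum_n_m f a b] is the sum of [f j] over a <= j <= b, and is zero if b < a.
   [Series] and [is_series] are indexed from 0, so a series over n >= 1 is
   written with general term at [S n]. *)

Definition H (n : nat) : R := sum_n_m (fun j => / INR j) 1 n.

Definition L (k n : nat) : R :=
  sum_n_m (fun j => (-1) ^ (j - 1) / INR j ^ k) 1 n.

Definition zeta (s : nat) : R := Series (fun n => / INR (S n) ^ s).

(* The general term (-1)^(n-1) / n^s at n = j + 1. *)
Definition zeta_bar (s : nat) : R := Series (fun j => (-1) ^ j / INR (S j) ^ s).

(* An argument of a multiple zeta-star value, possibly carrying a bar. *)
Inductive index : Set :=
| Plain (s : nat)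
| Bar (s : nat).

Definition index_term (i : index) (n : nat) : R :=
  match i with
  | Plain s => 1 / INR n ^ s
  | Bar s => (-1) ^ n / INR n ^ s
  end.

(* Sum over N >= n_1 >= n_2 >= ... >= n_k >= 1. *)
Fixpoint zeta_star_trunc (s : list index) (N : nat) : R :=
  match s with
  | [] => 1
  | i :: t => sum_n_m (fun n => index_term i n * zeta_star_trunc t n) 1 N
  end.

Definition zeta_star (s : list index) : R :=
  match s with
  | [] => 1
  | i :: t => Series (fun n => index_term i (S n) * zeta_star_trunc t (S n))
  end.

(* Main.v *)
(* Write s_k = (-1)^(k-1).  For p + q >= 1 consider the double sum over n <> k
   of H_n s_k / (n^p k^q (k^2 - n^2)), which converges absolutely because
   n^p k^q |k^2 - n^2| >= n k |k - n|.  Since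
     1/n^2 - 1/k^2 = (k^2 - n^2) / (n^2 k^2),
   moving two powers from k to n changes this sum by
   zetastar(p+2,1) zetabar(q+2) up to the diagonal n = k, so the convolution
   sums of the theorem are differences of two such double sums, those with
   (p,q) = (2m-1,0), (1,2m-2) and (2m-2,1), (0,2m-1) respectively.  In each of
   these one of the two summations, over k in the first and over n in the second
   sum of a pair, has a closed form in terms of harmonic numbers; the squares
   H_n^2 and the products H_n L_n(1) come from the pairs (1,2m-2) and (2m-2,1). *)
Require Import Defs.
From Stdlib Require Import Reals List Lra Lia.
From Coquelicot Require Import Coquelicot.
Import ListNotations.
Open Scope R_scope.

(** * Elementary series, harmonic numbers and the growth of [H] *)

Lemma is_series_eq (a b : nat -> R) (l l' : R) :
  (forall n, a n = b n) -> l = l' -> is_series a l -> is_series b l'.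
Proof. intros E <-. apply is_series_ext, E. Qed.

Lemma is_series_Rplus (a b : nat -> R) (la lb : R) :
  is_series a la -> is_series b lb -> is_series (fun n => a n + b n) (la + lb).
Proof. exact (is_series_plus a b la lb). Qed.

Lemma is_series_Rminus (a b : nat -> R) (la lb : R) :
  is_series a la -> is_series b lb -> is_series (fun n => a n - b n) (la - lb).
Proof. exact (is_series_minus a b la lb). Qed.

Lemma is_series_Rscal (c : R) (a : nat -> R) (l : R) :
  is_series a l -> is_series (fun n => c * a n) (c * l).
Proof. exact (is_series_scal c a l). Qed.

Lemma is_series_telescope (u : nat -> R) (l : R) :
  is_lim_seq u l -> is_series (fun j => u j - u (S j)) (u 0%nat - l).
Proof.
  intros Hu. apply is_lim_seq_incr_1 in Hu.
  assert (E : forall n, sum_n (fun j => u j - u (S j)) n = u 0%nat - u (S n)).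
  { induction n as [|n IH].
    - now rewrite sum_O.
    - rewrite sum_Sn, IH. unfold plus; simpl. ring. }
  change (is_lim_seq (sum_n (fun j => u j - u (S j))) (u 0%nat - l)).
  apply is_lim_seq_ext with (u := fun n => u 0%nat - u (S n)).
  - intros n. now rewrite E.
  - apply is_lim_seq_minus'; [apply is_lim_seq_const | exact Hu].
Qed.

Lemma is_lim_seq_inv_shift (c : nat) :
  is_lim_seq (fun j => / INR (S j + c)) 0.
Proof.
  apply is_lim_seq_ext with (u := fun j => (fun n => / INR n) (j + S c)%nat).
  { intros j. do 2 f_equal. lia. }
  apply (is_lim_seq_incr_n (fun n => / INR n) (S c)).
  replace (Finite 0) with (Rbar_inv p_infty) by reflexivity.
  apply is_lim_seq_inv; [apply is_lim_seq_INR | discriminate].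
Qed.

Lemma INR_S_pos (n : nat) : 0 < INR (S n).
Proof. apply lt_0_INR. lia. Qed.

Lemma INR_S_ge_1 (n : nat) : 1 <= INR (S n).
Proof. rewrite S_INR. pose proof (pos_INR n) as I1. lra. Qed.

Lemma inv_INR_S_bounds (n : nat) : 0 < / INR (S n) <= 1.
Proof.
  split; [apply Rinv_0_lt_compat, INR_S_pos |].
  rewrite <- Rinv_1. apply Rinv_le_contravar; [lra | apply INR_S_ge_1].
Qed.

Lemma ex_series_bound (a b : nat -> R) :
  (forall n, Rabs (a n) <= b n) -> ex_series b -> ex_series a.
Proof.
  exact (ex_series_le (K := R_AbsRing) (V := R_CompleteNormedModule) a b).
Qed.

Definition H2 (n : nat) : R := sum_n_m (fun j => / INR j ^ 2) 1 n.

Lemma sum_1_S (f : nat -> R) (n : nat) :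
  sum_n_m f 1 (S n) = sum_n_m f 1 n + f (S n) :> R.
Proof. apply (sum_n_Sm f 1 n). lia. Qed.

Lemma sum_1_S_l (f : nat -> R) (n : nat) :
  sum_n_m f 1 (S n) = f 1%nat + sum_n_m (fun i => f (S i)) 1 n :> R.
Proof. rewrite sum_n_m_S. apply (sum_Sn_m f 1). lia. Qed.

Lemma sum_1_ext (f g : nat -> R) (n : nat) :
  (forall i, (1 <= i <= n)%nat -> f i = g i) ->
  sum_n_m f 1 n = sum_n_m g 1 n :> R.
Proof. apply (sum_n_m_ext_loc f g). Qed.

Lemma sum_1_plus (f g : nat -> R) (n : nat) :
  sum_n_m (fun i => f i + g i) 1 n = sum_n_m f 1 n + sum_n_m g 1 n :> R.
Proof. apply (sum_n_m_plus f g). Qed.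

Lemma sum_1_scal (c : R) (f : nat -> R) (n : nat) :
  sum_n_m (fun i => c * f i) 1 n = c * sum_n_m f 1 n :> R.
Proof. apply (sum_n_m_mult_l (K := R_Ring) c f). Qed.

Lemma sum_1_0 (f : nat -> R) : sum_n_m f 1 0 = 0 :> R.
Proof. apply (sum_n_m_zero f). lia. Qed.

Lemma sum_1_sum_n (f : nat -> R) (n : nat) :
  sum_n_m f 1 (S n) = sum_n (fun j => f (S j)) n.
Proof. unfold sum_n. now rewrite sum_n_m_S. Qed.

Lemma H_0 : H 0 = 0.
Proof. apply sum_1_0. Qed.

Lemma H_S (n : nat) : H (S n) = H n + / INR (S n).
Proof. apply sum_1_S. Qed.

Lemma H2_0 : H2 0 = 0.
Proof. apply sum_1_0. Qed.

Lemma H2_S (n : nat) : H2 (S n) = H2 n + / INR (S n) ^ 2.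
Proof. apply sum_1_S. Qed.

Lemma H_nonneg (n : nat) : 0 <= H n.
Proof.
  induction n as [|n IH].
  - rewrite H_0. lra.
  - rewrite H_S. pose proof (inv_INR_S_bounds n) as I1. lra.
Qed.

Lemma H_ge_1 (n : nat) : 1 <= H (S n).
Proof.
  induction n as [|n IH].
  - rewrite H_S, H_0. simpl. lra.
  - rewrite H_S. pose proof (inv_INR_S_bounds (S n)) as I1. lra.
Qed.

Lemma H2_bounds (n : nat) : 0 <= H2 n <= H n.
Proof.
  induction n as [|n IH].
  - rewrite H_0, H2_0. lra.
  - rewrite H_S, H2_S, <- pow_inv. pose proof (inv_INR_S_bounds n) as I1. nra.
Qed.

(* The sequence [(H n ^ 2 + 2 * H n + 3) / n] decreases by at least
   [H n ^ 2 / (n * (n + 1))] at each step. *)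
Lemma ex_series_H_sq : ex_series (fun j => H (S j) ^ 2 / INR (S j) ^ 2).
Proof.
  set (g := fun j => (H (S j) ^ 2 + 2 * H (S j) + 3) / INR (S j)).
  (* The factor 2 pays for replacing [/ n ^ 2] by [/ (n * (n + 1))]. *)
  assert (step : forall j, H (S j) ^ 2 / INR (S j) ^ 2 <= 2 * (g j - g (S j))).
  { intros j. unfold g. rewrite (H_S (S j)).
    pose proof (H_nonneg (S j)) as Hh.
    pose proof (inv_INR_S_bounds j) as Ha.
    pose proof (inv_INR_S_bounds (S j)) as Hy.
    assert (E : / INR (S j) - / INR (S (S j)) = / INR (S j) * / INR (S (S j))).
    { rewrite !(S_INR (S j)). pose proof (INR_S_pos j) as I1. field. lra. }
    unfold Rdiv. rewrite <- pow_inv.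
    set (a := / INR (S j)) in *. set (y := / INR (S (S j))) in *.
    set (h := H (S j)) in *.
    replace (2 * _) with
      (2 * ((a - y) * (h ^ 2 + 2 * h + 3) - y * (2 * h * y + y ^ 2 + 2 * y)))
      by ring.
    rewrite E.
    (* Beyond [a * y * h ^ 2], the decrease of [g] consists of [2 * (h * y) * (a - y)] and
       [y * (3 * a - y ^ 2 - 2 * y)]; the summands [2 * H] and [3] of [g] make both nonnegative. *)
    assert (I2 : y <= a) by nra. assert (I3 : a <= 2 * y) by nra.
    assert (I4 : h ^ 2 * a ^ 2 <= h ^ 2 * (2 * (a * y)))
      by (apply Rmult_le_compat_l; nra).
    assert (I5 : 0 <= (h * y) * (a - y)) by (apply Rmult_le_pos; nra).
    assert (I6 : 0 <= y * (3 * a - y ^ 2 - 2 * y)) by (apply Rmult_le_pos; nra).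
    nra. }
  assert (pos : forall j, 0 <= H (S j) ^ 2 / INR (S j) ^ 2).
  { intros j. apply Rdiv_le_0_compat; [apply pow2_ge_0 |].
    apply pow_lt, INR_S_pos. }
  destruct (ex_finite_lim_seq_decr g 0) as [l Hl].
  { intros j. specialize (step j). specialize (pos j). lra. }
  { intros j. unfold g. pose proof (H_nonneg (S j)) as I7.
    apply Rdiv_le_0_compat; [nra | apply INR_S_pos]. }
  apply ex_series_bound with (b := fun j => 2 * (g j - g (S j))).
  - intros j. rewrite Rabs_pos_eq; [apply step | apply pos].
  - eexists. apply is_series_Rscal, is_series_telescope, Hl.
Qed.

(** One majorant serves zeta(2), the series of the theorem and the outer sums of the double sums. *)
Lemma ex_series_H_sq_bound (c : R) (u : nat -> R) :
  (forall j, Rabs (u j) <= c * (H (S j) ^ 2 / INR (S j) ^ 2)) -> ex_series u.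
Proof.
  intros Hu. apply ex_series_bound with (1 := Hu).
  apply (ex_series_scal (K := R_AbsRing) (V := R_NormedModule)), ex_series_H_sq.
Qed.

(** The general term of the convergent series [ex_series_H_sq] tends to 0, hence so does its square
    root. *)
Lemma is_lim_seq_H_div : is_lim_seq (fun j => H (S j) / INR (S j)) 0.
Proof.
  pose proof (ex_series_lim_0 _ ex_series_H_sq) as Hl.
  apply is_lim_seq_ext with
    (u := fun j => sqrt (H (S j) ^ 2 / INR (S j) ^ 2)).
  - intros j.
    replace (H (S j) ^ 2 / INR (S j) ^ 2) with (Rsqr (H (S j) / INR (S j))).
    + apply sqrt_Rsqr, Rdiv_le_0_compat; [apply H_nonneg | apply INR_S_pos].
    + unfold Rsqr. pose proof (INR_S_pos j) as I1. field. lra.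
  - rewrite <- sqrt_0.
    apply is_lim_seq_continuous; [apply continuity_pt_sqrt; lra | exact Hl].
Qed.

(** * Harmonic sums against shifted reciprocals *)

Lemma is_series_zeta_2 : is_series (fun j => / INR (S j) ^ 2) (zeta 2).
Proof.
  apply Series_correct, ex_series_H_sq_bound with 1. intros j.
  pose proof (inv_INR_S_bounds j) as I1. pose proof (H_ge_1 j) as I2.
  unfold Rdiv. rewrite <- pow_inv. rewrite Rabs_pos_eq by nra.
  assert (I3 : 1 <= H (S j) ^ 2) by nra.
  assert (I4 : 0 <= (/ INR (S j)) ^ 2) by nra. nra.
Qed.

(** Raising [n] by one adds a telescoping series whose sum is [/ (n + 1)]. *)
Lemma is_series_inv_diff (n : nat) :
  is_series (fun j => / INR (S j) - / INR (S j + n)) (H n).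
Proof.
  induction n as [|n IH].
  - rewrite H_0, <- (Rminus_0_r 0).
    apply is_series_eq with (a := fun j => 0 - (fun _ => 0) (S j)) (l := 0 - 0);
      [| reflexivity | exact (is_series_telescope _ _ (is_lim_seq_const 0))].
    intros j. rewrite Nat.add_0_r. ring.
  - refine (is_series_eq _ _ _ _ _ _
      (is_series_Rplus _ _ _ _ IH
         (is_series_telescope _ _ (is_lim_seq_inv_shift n)))).
    + intros j. simpl Nat.add. rewrite Nat.add_succ_r. ring.
    + rewrite H_S. simpl Nat.add. ring.
Qed.

Lemma is_series_inv_prod (n : nat) :
  is_series (fun j => / (INR (S j) * INR (S j + S n))) (H (S n) / INR (S n)).
Proof.
  refine (is_series_eq _ _ _ _ _ _
    (is_series_Rscal (/ INR (S n)) _ _ (is_series_inv_diff (S n)))).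
  - intros j. rewrite plus_INR.
    pose proof (INR_S_pos j) as I1. pose proof (INR_S_pos n) as I2. field. lra.
  - unfold Rdiv. ring.
Qed.

Lemma is_lim_seq_H_shift (c : nat) :
  is_lim_seq (fun j => H j / INR (S j + c)) 0.
Proof.
  apply is_lim_seq_le_le with
    (u := fun _ => 0) (w := fun j => H (S j) / INR (S j));
    [| apply is_lim_seq_const | apply is_lim_seq_H_div].
  intros j. pose proof (H_nonneg j) as I1. pose proof (INR_S_pos j) as I2.
  rewrite plus_INR. pose proof (pos_INR c) as I3. split.
  - apply Rdiv_le_0_compat; lra.
  - apply Rmult_le_compat; try lra.
    + apply Rlt_le, Rinv_0_lt_compat; lra.
    + rewrite H_S. pose proof (inv_INR_S_bounds j) as I4. lra.
    + apply Rinv_le_contravar; lra.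
Qed.

(** Summation by parts: since [H] grows by [/ (j + 1)], the term is a telescoping difference of
    [H j / (j + 1 + c)] plus the term of the given series. *)
Lemma is_series_abel_H (c : nat) (l : R) :
  is_series (fun j => / (INR (S j) * INR (S j + c))) l ->
  is_series (fun j => H (S j) * (/ INR (S j + c) - / INR (S j + S c))) l.
Proof.
  intros Hl.
  refine (is_series_eq _ _ _ _ _ _
    (is_series_Rplus _ _ _ _
       (is_series_telescope _ _ (is_lim_seq_H_shift c)) Hl)).
  - intros j. rewrite Nat.add_succ_r, !Nat.add_succ_l, H_S.
    pose proof (INR_S_pos j) as I1. pose proof (INR_S_pos (j + c)) as I2.
    pose proof (INR_S_pos (S (j + c))) as I3.
    field. lra.
  - rewrite H_0. unfold Rdiv. ring.
Qed.

(** The difference of reciprocals is split into unit steps. By [is_series_abel_H] the step at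
    [c = 0] gives [zeta 2] and the step at [c >= 1] gives [H c / c]; the latter add up to
    [(H n ^ 2 + H2 n) / 2]. *)
Lemma is_series_H_right (n : nat) :
  is_series (fun j => H (S j) * (/ INR (S j) - / INR (S j + S n)))
    (zeta 2 + (H n ^ 2 + H2 n) / 2).
Proof.
  induction n as [|n IH].
  - rewrite H_0, H2_0.
    assert (E : is_series (fun j => / (INR (S j) * INR (S j + 0))) (zeta 2)).
    { apply is_series_ext with (2 := is_series_zeta_2).
      intros j. rewrite Nat.add_0_r. f_equal. ring. }
    refine (is_series_eq _ _ _ _ _ _ (is_series_abel_H 0 _ E)).
    + intros j. now rewrite Nat.add_0_r.
    + field.
  - refine (is_series_eq _ _ _ _ _ _
      (is_series_Rplus _ _ _ _ IH
         (is_series_abel_H (S n) _ (is_series_inv_prod n)))).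
    + intros j. ring.
    + rewrite H_S, H2_S. pose proof (INR_S_pos n) as I1. field. lra.
Qed.

(** Supplies the terms past the pole in [is_series_H_left]. For [j >= 1], raising [n] by one adds
    [/ (j * (j + n + 1))] and a telescoping difference of [H (j + n) / (j + n)]. *)
Lemma is_series_H_left_tail (n : nat) :
  is_series (fun j => H (S j + n) * (/ INR (S j) - / INR (S j + n)))
    (H n ^ 2 + H2 n).
Proof.
  induction n as [|n IH].
  - rewrite H_0, H2_0.
    refine (is_series_eq _ _ _ _ _ _ (is_series_inv_diff 0)).
    + intros j. rewrite Nat.add_0_r. ring.
    + rewrite H_0. ring.
  - assert (Hl : is_lim_seq (fun j => H (S j + n) / INR (S j + n)) 0).
    { apply is_lim_seq_ext with
        (u := fun j => (fun i => H (S i) / INR (S i)) (j + n)%nat).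
      - reflexivity.
      - apply (is_lim_seq_incr_n (fun i => H (S i) / INR (S i))).
        apply is_lim_seq_H_div. }
    refine (is_series_eq _ _ _ _ _ _
      (is_series_Rplus _ _ _ _ IH
        (is_series_Rplus _ _ _ _ (is_series_inv_prod n)
          (is_series_telescope _ _ Hl)))).
    + intros j.
      replace (S (S j) + n)%nat with (S (S j + n)) by lia.
      replace (S j + S n)%nat with (S (S j + n)) by lia.
      rewrite H_S, (S_INR (S j + n)), plus_INR.
      pose proof (INR_S_pos j) as I1. pose proof (pos_INR n) as I2. field. lra.
    + simpl (1 + n)%nat. rewrite H_S, H2_S.
      pose proof (INR_S_pos n) as I3. field. lra.
Qed.

Lemma sum_1_rev (f : nat -> R) (n : nat) :
  sum_n_m (fun i => f (S n - i)%nat) 1 n = sum_n_m f 1 n :> R.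
Proof.
  induction n as [|n IH].
  - now rewrite !sum_1_0.
  - rewrite (sum_1_S f), <- IH, sum_1_S_l. apply Rplus_comm.
Qed.

Lemma sum_H_div (n : nat) :
  sum_n_m (fun i => H i / INR i) 1 n = (H n ^ 2 + H2 n) / 2 :> R.
Proof.
  induction n as [|n IH].
  - rewrite sum_1_0, H_0, H2_0. field.
  - rewrite sum_1_S, IH, H_S, H2_S. pose proof (INR_S_pos n) as I1. field. lra.
Qed.

Lemma sum_inv_conv (n : nat) :
  sum_n_m (fun i => / (INR i * INR (S n - i))) 1 n = 2 * H n / INR (S n) :> R.
Proof.
  rewrite (sum_1_ext _
    (fun i => / INR (S n) * (/ INR i + / INR (S n - i)))).
  - rewrite sum_1_scal, sum_1_plus, (sum_1_rev (fun i => / INR i)).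
    change (sum_n_m (fun i => / INR i) 1 n) with (H n).
    unfold Rdiv. ring.
  - intros i Hi. rewrite minus_INR by lia.
    assert (I1 : 0 < INR i) by (apply lt_0_INR; lia).
    assert (I2 : INR i < INR (S n)) by (apply lt_INR; lia).
    field. lra.
Qed.

(** Splitting [H i] as [H (i - 1) + / i] leaves the convolution for the preceding [n], after a shift
    of the index, and the sum [sum_inv_conv]. *)
Lemma sum_H_conv (n : nat) :
  sum_n_m (fun i => H i / INR (S n - i)) 1 n = H (S n) ^ 2 - H2 (S n) :> R.
Proof.
  induction n as [|n IH].
  - rewrite sum_1_0, H_S, H2_S, H_0, H2_0. simpl. field.
  - rewrite (sum_1_ext _ (fun i => H (i - 1) / INR (S (S n) - i)
          + / (INR i * INR (S (S n) - i)))).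
    + rewrite sum_1_plus, sum_inv_conv, sum_1_S_l.
      rewrite (sum_1_ext _ (fun i => H i / INR (S n - i))).
      * rewrite IH, (H_S (S n)), (H2_S (S n)). simpl (1 - 1)%nat.
        rewrite H_0. pose proof (INR_S_pos (S n)) as I1.
        unfold Rdiv at 1. rewrite Rmult_0_l. field. lra.
      * intros i Hi. do 2 f_equal; lia.
    + intros [|i] Hi; [lia |].
      replace (S i - 1)%nat with i by lia. rewrite H_S.
      pose proof (INR_S_pos i) as I1.
      assert (I2 : 0 < INR (S (S n) - S i)) by (apply lt_0_INR; lia).
      field. lra.
Qed.

(** * Series without their diagonal term, and sums against 1/(k^2 - n^2) *)

Lemma is_series_prefix (a : nat -> R) (n : nat) (l : R) :
  is_series (fun k => a (k + S n)%nat) l ->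
  is_series a (sum_n a n + l).
Proof.
  intros Hl. apply (is_series_decr_n a (S n)); [lia |].
  refine (is_series_eq _ _ _ _ _ _ Hl).
  - intros k. f_equal. lia.
  - simpl pred. change (l = sum_n a n + l + - sum_n a n). ring.
Qed.

Lemma sum_n_off_diag (f : nat -> R) (n : nat) :
  sum_n (fun j => if Nat.eqb j n then 0 else f j) n = sum_n f n - f n :> R.
Proof.
  destruct n as [|n].
  - rewrite !sum_O. simpl. ring.
  - rewrite !sum_Sn, Nat.eqb_refl.
    rewrite (sum_n_ext_loc _ f).
    + change (sum_n f n + 0 = sum_n f n + f (S n) - f (S n)). ring.
    + intros k Hk. destruct (Nat.eqb_spec k (S n)); [lia | reflexivity].
Qed.

(** Meant for summands with a pole at [S n]: the parts before and after it are summed separately.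
    [is_series_off_diag] treats summands that are regular there. *)
Lemma is_series_omit (g : nat -> R) (n : nat) (l : R) :
  is_series (fun k => g (S k + S n)%nat) l ->
  is_series (fun j => if Nat.eqb j n then 0 else g (S j)) (sum_n_m g 1 n + l).
Proof.
  intros Hl.
  refine (is_series_eq _ _ _ _ (fun _ => eq_refl) _
            (is_series_prefix _ n l _)).
  - rewrite (sum_n_off_diag (fun j => g (S j))), <- sum_1_sum_n, sum_1_S. ring.
  - refine (is_series_eq _ _ _ _ _ eq_refl Hl). intros k. simpl Nat.add.
    destruct (Nat.eqb_spec (k + S n) n); [lia | reflexivity].
Qed.

Lemma is_series_off_diag (f : nat -> R) (n : nat) (l : R) :
  is_series f l ->
  is_series (fun j => if Nat.eqb j n then 0 else f j) (l - f n).
Proof.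
  intros Hl.
  refine (is_series_eq _ _ _ _ (fun _ => eq_refl) _
            (is_series_prefix _ n (l - sum_n f n) _)).
  - rewrite sum_n_off_diag. ring.
  - refine (is_series_eq _ _ _ _ _ eq_refl (is_series_incr_n f (S n) _ _ _)).
    + intros k. destruct (Nat.eqb_spec (k + S n) n); [lia |]. f_equal. lia.
    + lia.
    + refine (is_series_eq _ _ _ _ (fun _ => eq_refl) _ Hl).
      simpl pred. change (l = l - sum_n f n + sum_n f n). ring.
Qed.

Lemma is_series_H_left (n : nat) :
  is_series (fun j => if Nat.eqb j n then 0 else
      H (S j) * (/ (INR (S j) - INR (S n)) - / INR (S j)))
    ((3 * H2 (S n) - H (S n) ^ 2) / 2 + H (S n) / INR (S n)).
Proof.
  refine (is_series_eq _ _ _ _ (fun _ => eq_refl) _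
    (is_series_omit
      (fun i => H i * (/ (INR i - INR (S n)) - / INR i)) n _
      (is_series_eq _ _ _ _ _ eq_refl (is_series_H_left_tail (S n))))).
  (* Before the pole the summand is minus a convolution term minus [H i / i], and both have closed
     sums. *)
  - rewrite (sum_1_ext _
      (fun i => (-1) * (H i / INR (S n - i) + H i / INR i))).
    + rewrite sum_1_scal, sum_1_plus, sum_H_conv, sum_H_div, H_S, H2_S.
      pose proof (INR_S_pos n) as I1. field. lra.
    + intros i Hi. rewrite minus_INR by lia.
      assert (I1 : 0 < INR i) by (apply lt_0_INR; lia).
      assert (I2 : INR i < INR (S n)) by (apply lt_INR; lia).
      field. lra.
  - intros j. cbv beta. rewrite plus_INR.
    replace (INR (S j) + INR (S n) - INR (S n)) with (INR (S j)) by ring.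
    reflexivity.
Qed.

(** The value 0 on the diagonal lets sums over [n <> k] run over all pairs. *)
Definition kernel (n k : nat) : R :=
  if Nat.eqb k n then 0 else / (INR k ^ 2 - INR n ^ 2).

Lemma kernel_antisym (n k : nat) : kernel k n = - kernel n k.
Proof.
  unfold kernel. rewrite (Nat.eqb_sym n k).
  destruct (Nat.eqb_spec k n) as [|E]; [ring |].
  rewrite <- Rinv_opp. f_equal. ring.
Qed.

Lemma INR_S_minus_neq_0 (n j : nat) : j <> n -> INR (S j) - INR (S n) <> 0.
Proof. intros E C. apply E, Nat.succ_inj, INR_eq. lra. Qed.

Lemma INR_S_sq_minus_neq_0 (n j : nat) :
  j <> n -> INR (S j) ^ 2 - INR (S n) ^ 2 <> 0.
Proof.
  intros E. apply INR_S_minus_neq_0 in E.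
  pose proof (INR_S_pos n) as I1. pose proof (INR_S_pos j) as I2.
  replace (_ - _) with ((INR (S j) - INR (S n)) * (INR (S j) + INR (S n)))
    by ring.
  apply Rmult_integral_contrapositive; split; lra.
Qed.

(** Partial fractions: 2n/(k^2 - n^2) = (1/(k-n) - 1/k) + (1/k - 1/(k+n)). Inserting 1/k makes both
    parts converge for [f = H]. The second part is regular at k = n, and its term f(n)/(2n) there is
    taken out. *)
Lemma is_series_kernel (f : nat -> R) (n : nat) (p q : R) :
  is_series (fun j => if Nat.eqb j n then 0 else
    f (S j) * (/ (INR (S j) - INR (S n)) - / INR (S j))) p ->
  is_series (fun j => f (S j) * (/ INR (S j) - / INR (S j + S n))) q ->
  is_series (fun j => f (S j) * kernel (S n) (S j))
    ((p + q - f (S n) / (2 * INR (S n))) / (2 * INR (S n))).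
Proof.
  intros Hp Hq. refine (is_series_eq _ _ _ _ _ _
    (is_series_Rscal (/ (2 * INR (S n))) _ _
      (is_series_Rplus _ _ _ _ Hp (is_series_off_diag _ n _ Hq)))).
  - intros j. unfold kernel. simpl Nat.eqb.
    destruct (Nat.eqb_spec j n) as [|E]; [ring |].
    pose proof (INR_S_pos n) as I1. pose proof (INR_S_pos j) as I2.
    pose proof (INR_S_minus_neq_0 n j E) as I3.
    rewrite plus_INR. field. repeat split; try lra.
    apply INR_S_sq_minus_neq_0, E.
  - rewrite plus_INR. pose proof (INR_S_pos n) as I1. field. lra.
Qed.

(** The same two parts, now subtracted: 2n^2/(k(k^2 - n^2)) = (1/(k-n) - 1/k) - (1/k - 1/(k+n)). *)
Lemma is_series_div_kernel (f : nat -> R) (n : nat) (p q : R) :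
  is_series (fun j => if Nat.eqb j n then 0 else
    f (S j) * (/ (INR (S j) - INR (S n)) - / INR (S j))) p ->
  is_series (fun j => f (S j) * (/ INR (S j) - / INR (S j + S n))) q ->
  is_series (fun j => f (S j) / INR (S j) * kernel (S n) (S j))
    ((p - q + f (S n) / (2 * INR (S n))) / (2 * INR (S n) ^ 2)).
Proof.
  intros Hp Hq. refine (is_series_eq _ _ _ _ _ _
    (is_series_Rscal (/ (2 * INR (S n) ^ 2)) _ _
      (is_series_Rminus _ _ _ _ Hp (is_series_off_diag _ n _ Hq)))).
  - intros j. unfold kernel. simpl Nat.eqb.
    destruct (Nat.eqb_spec j n) as [|E]; [ring |].
    pose proof (INR_S_pos n) as I1. pose proof (INR_S_pos j) as I2.
    pose proof (INR_S_minus_neq_0 n j E) as I3.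
    rewrite plus_INR. field. repeat split; try lra.
    apply INR_S_sq_minus_neq_0, E.
  - rewrite plus_INR. pose proof (INR_S_pos n) as I1. field. lra.
Qed.

(** The squares of [H] in the two parts cancel here; in [is_series_H_div_kernel], where the parts
    are subtracted, they reinforce each other. *)
Lemma is_series_H_kernel (n : nat) :
  is_series (fun j => H (S j) * kernel (S n) (S j))
    ((2 * H2 (S n) + zeta 2 - H (S n) / (2 * INR (S n))) / (2 * INR (S n))).
Proof.
  refine (is_series_eq _ _ _ _ (fun _ => eq_refl) _
    (is_series_kernel H n _ _ (is_series_H_left n) (is_series_H_right n))).
  rewrite H_S, H2_S. pose proof (INR_S_pos n) as I1. field. lra.
Qed.

Lemma is_series_H_div_kernel (n : nat) :
  is_series (fun j => H (S j) / INR (S j) * kernel (S n) (S j))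
    ((H2 (S n) - H (S n) ^ 2 + 5 * H (S n) / (2 * INR (S n)) - zeta 2)
     / (2 * INR (S n) ^ 2)).
Proof.
  refine (is_series_eq _ _ _ _ (fun _ => eq_refl) _
    (is_series_div_kernel H n _ _ (is_series_H_left n) (is_series_H_right n))).
  rewrite H_S, H2_S. pose proof (INR_S_pos n) as I1. field. lra.
Qed.

(** * Alternating sums against shifted reciprocals *)

(** Up to sign, the tail of the alternating harmonic series after [n] terms; the integral shows that
    it is nonnegative and equals [ln 2] at 0. *)
Definition alt_int (n : nat) : R := RInt (fun x => x ^ n / (1 + x)) 0 1.

Lemma is_RInt_alt_int (n : nat) : is_RInt (fun x => x ^ n / (1 + x)) 0 1 (alt_int n).
Proof.
  apply (RInt_correct (V := R_CompleteNormedModule)), ex_RInt_continuous.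
  intros x Hx. rewrite Rmin_left, Rmax_right in Hx by lra.
  apply (ex_derive_continuous (K := R_AbsRing) (V := R_NormedModule)).
  auto_derive. lra.
Qed.

Lemma alt_int_0 : alt_int 0 = ln 2.
Proof.
  apply is_RInt_unique.
  replace (ln 2) with (minus (ln (1 + 1)) (ln (1 + 0))).
  - apply (is_RInt_derive (fun x => ln (1 + x)) (fun x => x ^ 0 / (1 + x)));
      intros x Hx; rewrite Rmin_left, Rmax_right in Hx by lra.
    + auto_derive; [lra | simpl; field; lra].
    + apply (ex_derive_continuous (K := R_AbsRing) (V := R_NormedModule)).
      auto_derive. lra.
  - rewrite Rplus_0_r, ln_1. change (ln (1 + 1) - 0 = ln 2).
    replace (1 + 1) with 2 by ring. ring.
Qed.

Lemma alt_int_nonneg (n : nat) : 0 <= alt_int n.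
Proof.
  apply RInt_ge_0; [lra | eexists; apply is_RInt_alt_int |].
  intros x Hx. apply Rdiv_le_0_compat; [apply pow_le; lra | lra].
Qed.

Lemma alt_int_add_S (n : nat) : alt_int n + alt_int (S n) = / INR (S n).
Proof.
  pose proof (INR_S_pos n) as I1.
  assert (E : is_RInt (fun x => x ^ n) 0 1 (/ INR (S n))).
  { replace (/ INR (S n)) with
      (minus (1 ^ S n / INR (S n)) (0 ^ S n / INR (S n))).
    - apply (is_RInt_derive (fun x => x ^ S n / INR (S n)) (fun x => x ^ n));
        intros x _.
      + auto_derive; [easy |]. simpl pred. field. apply Rgt_not_eq, I1.
      + apply (ex_derive_continuous (K := R_AbsRing) (V := R_NormedModule)).
        auto_derive. easy.
    - rewrite pow1, pow_i by lia.
      change (1 / INR (S n) - 0 / INR (S n) = / INR (S n)). field. lra. }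
  rewrite <- (is_RInt_unique _ _ _ _ E). symmetry. apply is_RInt_unique.
  apply is_RInt_ext with
    (f := fun x => plus (x ^ n / (1 + x)) (x ^ S n / (1 + x))).
  - intros x Hx. rewrite Rmin_left, Rmax_right in Hx by lra.
    change (x ^ n / (1 + x) + x ^ S n / (1 + x) = x ^ n). simpl. field. lra.
  - apply (is_RInt_plus (V := R_NormedModule)); apply is_RInt_alt_int.
Qed.

(* Writing [/ (j + 1) = alt_int j + alt_int (j + 1)] makes the series telescope. *)
Lemma is_series_ln_2 : is_series (fun j => (-1) ^ j / INR (S j)) (ln 2).
Proof.
  assert (Hl : is_lim_seq (fun j => (-1) ^ j * alt_int j) 0).
  { apply is_lim_seq_abs_0.
    apply is_lim_seq_le_le with (u := fun _ => 0) (w := fun j => / INR (S j + 0)).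
    - intros j. rewrite Rabs_mult, pow_1_abs, Rmult_1_l, Nat.add_0_r.
      pose proof (alt_int_nonneg j) as I1. pose proof (alt_int_nonneg (S j)) as I2.
      pose proof (alt_int_add_S j) as I3. rewrite Rabs_pos_eq; lra.
    - apply is_lim_seq_const.
    - apply is_lim_seq_inv_shift. }
  refine (is_series_eq _ _ _ _ _ _ (is_series_telescope _ _ Hl)).
  - intros j. unfold Rdiv. rewrite <- alt_int_add_S. simpl. ring.
  - rewrite alt_int_0. simpl. ring.
Qed.

Lemma L_S (k n : nat) : L k (S n) = L k n + (-1) ^ n / INR (S n) ^ k.
Proof.
  unfold L. rewrite sum_1_S. do 3 f_equal. lia.
Qed.

Lemma pow_m1_sq (n : nat) : (-1) ^ n * (-1) ^ n = 1.
Proof.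
  rewrite <- Rpow_mult_distr. replace (-1 * -1) with 1 by ring. apply pow1.
Qed.

(** Dropping the first term and changing the sign raises [n] by one. *)
Lemma is_series_alt_shift (n : nat) :
  is_series (fun j => (-1) ^ j / INR (S j + n)) ((-1) ^ n * (ln 2 - L 1 n)).
Proof.
  induction n as [|n IH].
  - refine (is_series_eq _ _ _ _ _ _ is_series_ln_2).
    + intros j. now rewrite Nat.add_0_r.
    + unfold L. rewrite sum_1_0. simpl. ring.
  - refine (is_series_eq _ _ _ _ _ _
      (is_series_Rscal (-1) _ _ (is_series_incr_1 _ _
        (is_series_eq _ _ _ ((-1) ^ n * (ln 2 - L 1 n) - / INR (S n)
           + (-1) ^ 0 / INR (1 + n)) (fun _ => eq_refl) _ IH)))).
    + intros j. cbv beta. replace (S j + S n)%nat with (S (S j) + n)%nat by lia.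
      simpl pow. unfold Rdiv. ring.
    + rewrite L_S, pow_1. simpl pow. pose proof (INR_S_pos n) as I1.
      transitivity (-1 * ((-1) ^ n * (ln 2 - L 1 n)) + 1 * / INR (S n)); [ring |].
      rewrite <- (pow_m1_sq n). unfold Rdiv. ring.
    + simpl Nat.add. simpl pow. field. apply Rgt_not_eq, INR_S_pos.
Qed.

Lemma is_series_alt_right (n : nat) :
  is_series (fun j => (-1) ^ (S j - 1) * (/ INR (S j) - / INR (S j + n)))
    (ln 2 - (-1) ^ n * (ln 2 - L 1 n)).
Proof.
  refine (is_series_eq _ _ _ _ _ eq_refl
    (is_series_Rminus _ _ _ _ is_series_ln_2 (is_series_alt_shift n))).
  intros j. replace (S j - 1)%nat with j by lia. unfold Rdiv. ring.
Qed.

(** Before the pole, the reflection of [i] to [S n - i] turns the singular part into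
    [(-1) ^ n * L 1 n]. Past it, a shift by [S n] gives [is_series_alt_right] with the sign
    [(-1) ^ S n]. *)
Lemma is_series_alt_left (n : nat) :
  is_series (fun j => if Nat.eqb j n then 0 else
      (-1) ^ (S j - 1) * (/ (INR (S j) - INR (S n)) - / INR (S j)))
    ((-1) ^ S n * (ln 2 - L 1 (S n)) - ln 2 - / INR (S n)
     - (-1) ^ S n / INR (S n)).
Proof.
  refine (is_series_eq _ _ _ _ (fun _ => eq_refl) _
    (is_series_omit
      (fun i => (-1) ^ (i - 1) * (/ (INR i - INR (S n)) - / INR i)) n _
      (is_series_eq _ _ _ _ _ eq_refl
        (is_series_Rscal ((-1) ^ S n) _ _ (is_series_alt_right (S n)))))).
  - rewrite (sum_1_ext _ (fun i => (-1) ^ n *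
      ((-1) ^ (S n - i - 1) / INR (S n - i) ^ 1)
      + (-1) * ((-1) ^ (i - 1) / INR i ^ 1))).
    + rewrite sum_1_plus, !sum_1_scal.
      rewrite (sum_1_rev (fun i => (-1) ^ (i - 1) / INR i ^ 1)).
      change (sum_n_m _ 1 n) with (L 1 n).
      rewrite L_S, pow_1. pose proof (INR_S_pos n) as I1.
      (* [field] does not know that [(-1) ^ n] squares to 1, so the squares are isolated on both
         sides for [pow_m1_sq]. *)
      transitivity ((-1) ^ n * L 1 n - L 1 n - (-1) ^ n * ln 2
        - ((-1) ^ n * (-1) ^ n) * (ln 2 - L 1 n - (-1) ^ n / INR (S n)));
        [simpl pow; field; lra |].
      transitivity (- (-1) ^ n * (ln 2 - L 1 n)
        + ((-1) ^ n * (-1) ^ n) / INR (S n) - ln 2 - / INR (S n)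
        + (-1) ^ n / INR (S n)); [| simpl pow; field; lra].
      rewrite pow_m1_sq. field. lra.
    + intros [|i] Hi; [lia |].
      assert (E : (-1) ^ n * (-1) ^ (S n - S i - 1) = (-1) ^ S i).
      { replace n with (S i + (S n - S i - 1))%nat at 1 by lia.
        rewrite pow_add, Rmult_assoc, pow_m1_sq. ring. }
      unfold Rdiv. rewrite <- Rmult_assoc, E, !pow_1, minus_INR by lia.
      replace (S i - 1)%nat with i by lia. simpl pow.
      pose proof (INR_S_pos i) as I1.
      assert (I2 : INR (S i) < INR (S n)) by (apply lt_INR; lia).
      field. lra.
  - intros j. cbv beta.
    replace (S j + S n - 1)%nat with (j + S n)%nat by lia.
    replace (S j - 1)%nat with j by lia.
    rewrite pow_add, plus_INR.
    replace (INR (S j) + INR (S n) - INR (S n)) with (INR (S j)) by ring. ring.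
Qed.

(** The contributions of [ln 2] and [L] in the two parts cancel; in [is_series_alt_div_kernel] they
    double. *)
Lemma is_series_alt_kernel (n : nat) :
  is_series (fun j => (-1) ^ (S j - 1) * kernel (S n) (S j))
    ((- / INR (S n) - (-1) ^ S n / (2 * INR (S n))) / (2 * INR (S n))).
Proof.
  refine (is_series_eq _ _ _ _ (fun _ => eq_refl) _
    (is_series_kernel (fun i => (-1) ^ (i - 1)) n _ _
      (is_series_alt_left n) (is_series_alt_right (S n)))).
  replace (S n - 1)%nat with n by lia. simpl pow.
  pose proof (INR_S_pos n) as I1. field; repeat split; apply Rgt_not_eq, I1.
Qed.

Lemma is_series_alt_div_kernel (n : nat) :
  is_series (fun j => (-1) ^ (S j - 1) / INR (S j) * kernel (S n) (S j))
    ((2 * (-1) ^ S n * (ln 2 - L 1 (S n)) - 2 * ln 2 - / INR (S n)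
      - 3 / 2 * (-1) ^ S n / INR (S n)) / (2 * INR (S n) ^ 2)).
Proof.
  refine (is_series_eq _ _ _ _ (fun _ => eq_refl) _
    (is_series_div_kernel (fun i => (-1) ^ (i - 1)) n _ _
      (is_series_alt_left n) (is_series_alt_right (S n)))).
  replace (S n - 1)%nat with n by lia. simpl pow.
  pose proof (INR_S_pos n) as I1. field; repeat split; apply Rgt_not_eq, I1.
Qed.

(** * Interchanging summations *)

Lemma sum_n_le_series (b : nat -> R) (l : R) :
  (forall n, 0 <= b n) -> is_series b l -> forall n, sum_n b n <= l.
Proof.
  intros Hb Hl. apply is_lim_seq_incr_compare; [exact Hl |].
  intros n. rewrite sum_Sn. change (sum_n b n <= sum_n b n + b (S n)).
  specialize (Hb (S n)). lra.
Qed.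

Lemma is_lim_seq_sum_n (f : nat -> nat -> R) (g : nat -> R) (n : nat) :
  (forall i, is_lim_seq (fun k => f k i) (g i)) ->
  is_lim_seq (fun k => sum_n (f k) n) (sum_n g n).
Proof.
  intros Hf. induction n as [|n IH].
  - rewrite sum_O. apply is_lim_seq_ext with (2 := Hf 0%nat).
    intros k. now rewrite sum_O.
  - rewrite sum_Sn.
    apply is_lim_seq_ext with (u := fun k => sum_n (f k) n + f k (S n)).
    + intros k. now rewrite sum_Sn.
    + apply is_lim_seq_plus'; [exact IH | apply Hf].
Qed.

(** Dominated convergence for series (Tannery's theorem). *)
Lemma is_lim_seq_series (f : nat -> nat -> R) (g b : nat -> R) :
  (forall k n, Rabs (f k n) <= b n) -> ex_series b ->
  (forall n, is_lim_seq (fun k => f k n) (g n)) ->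
  is_lim_seq (fun k => Series (f k)) (Series g).
Proof.
  intros Hb Eb Hf.
  assert (Hg : forall n, Rabs (g n) <= b n).
  { intros n.
    refine (is_lim_seq_le _ _ (Rabs (g n)) (b n) (fun k => Hb k n) _ _).
    - apply (is_lim_seq_abs _ (g n)), Hf.
    - apply is_lim_seq_const. }
  assert (Et : forall N, ex_series (fun n => b (S N + n)%nat)).
  { intros N. now apply (ex_series_incr_n b (S N)). }
  (* Up to twice the tail of [b], the two series agree with their partial sums. *)
  assert (tail : forall N k, Rabs (Series (f k) - Series g) <=
    Rabs (sum_n (f k) N - sum_n g N) + 2 * (Series b - sum_n b N)).
  { intros N k.
    assert (bd : forall u : nat -> R, (forall n, Rabs (u n) <= b n) ->
      Rabs (Series u - sum_n u N) <= Series b - sum_n b N).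
    { intros u Hu. pose proof (ex_series_bound _ _ Hu Eb) as Eu.
      rewrite (Series_incr_n u (S N)), (Series_incr_n b (S N)),
        <- !sum_n_Reals by (lia || assumption).
      simpl pred.
      replace (_ + _ - sum_n u N) with (Series (fun i => u (S N + i)%nat))
        by (change plus with Rplus; ring).
      replace (_ + _ - sum_n b N) with (Series (fun i => b (S N + i)%nat))
        by ring.
      assert (Ea : ex_series (fun i => Rabs (u (S N + i)%nat))).
      { apply ex_series_bound with (2 := Et N).
        intros i. rewrite Rabs_Rabsolu. apply Hu. }
      eapply Rle_trans; [apply Series_Rabs, Ea |].
      apply Series_le; [| apply Et].
      intros i. split; [apply Rabs_pos | apply Hu]. }
    pose proof (bd _ (Hb k)) as I1. pose proof (bd _ Hg) as I2.
    replace (Series (f k) - Series g) with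
      ((Series (f k) - sum_n (f k) N) + (sum_n (f k) N - sum_n g N)
       - (Series g - sum_n g N)) by ring.
    unfold Rminus at 1.
    eapply Rle_trans; [apply Rabs_triang |].
    rewrite Rabs_Ropp.
    pose proof (Rabs_triang (Series (f k) - sum_n (f k) N)
                  (sum_n (f k) N - sum_n g N)) as I3. lra. }
  apply is_lim_seq_spec. intros eps.
  pose proof (Series_correct _ Eb) as Lb.
  change (is_lim_seq (sum_n b) (Series b)) in Lb.
  apply is_lim_seq_spec in Lb.
  (* One quarter for the partial sums and two for the tails stay below [eps]. *)
  assert (He : 0 < eps / 4) by (pose proof (cond_pos eps); lra).
  destruct (Lb (mkposreal _ He)) as [N HN]. specialize (HN N (le_n N)).
  simpl in HN.
  pose proof (is_lim_seq_sum_n f g N Hf) as Lf.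
  apply is_lim_seq_spec in Lf.
  destruct (Lf (mkposreal _ He)) as [k0 Hk]. exists k0. intros k Hk0.
  specialize (Hk k Hk0). simpl in Hk. specialize (tail N k).
  apply Rabs_def2 in HN. lra.
Qed.

(** A finite sum over [k] commutes with the series over [n]; the row sums [b] of the majorant then
    dominate the passage to infinitely many [k]. *)
Lemma is_series_swap (a M : nat -> nat -> R) (b : nat -> R) :
  (forall n k, Rabs (a n k) <= M n k) ->
  (forall n, is_series (M n) (b n)) -> ex_series b ->
  is_series (fun k => Series (fun n => a n k)) (Series (fun n => Series (a n))).
Proof.
  intros Ha HM Eb.
  assert (M0 : forall n k, 0 <= M n k).
  { intros n k. eapply Rle_trans; [apply Rabs_pos | apply Ha]. }
  assert (part : forall n k, sum_n (M n) k <= b n).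
  { intros n. apply sum_n_le_series; [apply M0 | apply HM]. }
  assert (sum_abs : forall n k, Rabs (sum_n (a n) k) <= sum_n (M n) k).
  { intros n. induction k as [|k IH].
    - rewrite !sum_O. apply Ha.
    - rewrite !sum_Sn.
      change (Rabs (sum_n (a n) k + a n (S k)) <= sum_n (M n) k + M n (S k)).
      eapply Rle_trans; [apply Rabs_triang |].
      apply Rplus_le_compat; [exact IH | apply Ha]. }
  assert (En : forall k, ex_series (fun n => a n k)).
  { intros k. apply ex_series_bound with (2 := Eb). intros n.
    eapply Rle_trans; [apply Ha |]. eapply Rle_trans; [| apply (part n k)].
    destruct k as [|k]; [rewrite sum_O; apply Rle_refl |].
    rewrite sum_Sn. change (M n (S k) <= sum_n (M n) k + M n (S k)).
    pose proof (sum_abs n k) as I1. pose proof (Rabs_pos (sum_n (a n) k)) as I2.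
    lra. }
  assert (E : forall k,
    ex_series (fun n => sum_n (a n) k) /\
    Series (fun n => sum_n (a n) k) = sum_n (fun k => Series (fun n => a n k)) k).
  { induction k as [|k [IH1 IH2]].
    - split.
      + apply ex_series_ext with (2 := En 0%nat). intros n. now rewrite sum_O.
      + rewrite sum_O. apply Series_ext. intros n. now rewrite sum_O.
    - split.
      + apply ex_series_ext with (a := fun n => plus (sum_n (a n) k) (a n (S k))).
        * intros n. now rewrite sum_Sn.
        * apply (ex_series_plus (K := R_AbsRing) (V := R_NormedModule));
            [exact IH1 | apply En].
      + rewrite sum_Sn, <- IH2. change plus with Rplus.
        rewrite <- Series_plus by (exact IH1 || apply En).
        apply Series_ext. intros n. now rewrite sum_Sn. }
  change (is_lim_seq (sum_n (fun k => Series (fun n => a n k)))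
            (Series (fun n => Series (a n)))).
  apply is_lim_seq_ext with (u := fun k => Series (fun n => sum_n (a n) k)).
  - intros k. apply E.
  - apply is_lim_seq_series with (b := b); [| exact Eb |].
    + intros k n. eapply Rle_trans; [apply sum_abs | apply part].
    + intros n. apply (Series_correct (a n)).
      apply ex_series_bound with (1 := Ha n). eexists. apply HM.
Qed.

(** The part [2 * H n] comes from the indices below the diagonal, by [sum_inv_conv], and [H (S n)]
    from those above it, by [is_series_inv_diff]. *)
Lemma is_series_majorant (n : nat) :
  is_series (fun j => if Nat.eqb j n then 0 else
      / (INR (S n) * INR (S j) * Rabs (INR (S j) - INR (S n))))
    ((2 * H n + H (S n)) / INR (S n) ^ 2).
Proof.
  pose proof (INR_S_pos n) as I1.
  refine (is_series_eq _ _ _ _ (fun _ => eq_refl) _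
    (is_series_omit
      (fun i => / (INR (S n) * INR i * Rabs (INR i - INR (S n)))) n _
      (is_series_eq _ _ _ _ _ eq_refl
        (is_series_Rscal (/ INR (S n) ^ 2) _ _ (is_series_inv_diff (S n)))))).
  - rewrite (sum_1_ext _ (fun i => / INR (S n) * / (INR i * INR (S n - i)))).
    + rewrite sum_1_scal, sum_inv_conv. field. lra.
    + intros i Hi. rewrite minus_INR by lia.
      assert (I2 : 0 < INR i) by (apply lt_0_INR; lia).
      assert (I3 : INR i < INR (S n)) by (apply lt_INR; lia).
      rewrite Rabs_left by lra. field. lra.
  - intros j. cbv beta. rewrite plus_INR. pose proof (INR_S_pos j) as I2.
    rewrite Rabs_pos_eq by lra. field. lra.
Qed.

(** * The double sums and their absolute convergence *)

Definition double_term (p q n k : nat) : R :=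
  H (S n) / INR (S n) ^ p * ((-1) ^ (S k - 1) / INR (S k) ^ q * kernel (S n) (S k)).

Lemma pow_inv_INR_S_le_1 (p n : nat) : 0 < (/ INR (S n)) ^ p <= 1.
Proof.
  pose proof (inv_INR_S_bounds n) as I1. split; [apply pow_lt; lra |].
  rewrite <- (pow1 p). apply pow_incr. lra.
Qed.

(** The hypothesis provides a factor 1/n or 1/k. The other one comes from |k^2 - n^2| = (k + n)|k -
    n|, as 1/(k + n) is at most 1/k and at most 1/n. *)
Lemma double_term_bound (p q n k : nat) : (1 <= p + q)%nat ->
  Rabs (double_term p q n k) <= H (S n) * (if Nat.eqb k n then 0 else
      / (INR (S n) * INR (S k) * Rabs (INR (S k) - INR (S n)))).
Proof.
  intros Hpq. unfold double_term, kernel. simpl Nat.eqb.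
  destruct (Nat.eqb_spec k n) as [|E].
  { rewrite !Rmult_0_r, Rabs_R0. lra. }
  pose proof (H_nonneg (S n)) as I1.
  pose proof (INR_S_pos n) as I2. pose proof (INR_S_pos k) as I3.
  pose proof (INR_S_minus_neq_0 n k E) as I4.
  unfold Rdiv. rewrite <- !pow_inv, !Rabs_mult, pow_1_abs, Rmult_1_l.
  rewrite (Rabs_pos_eq (H (S n))) by assumption.
  rewrite !(Rabs_pos_eq ((/ _) ^ _)) by apply Rlt_le, pow_inv_INR_S_le_1.
  rewrite Rmult_assoc. apply Rmult_le_compat_l; [assumption |].
  replace (INR (S k) ^ 2 - INR (S n) ^ 2) with
    ((INR (S k) + INR (S n)) * (INR (S k) - INR (S n))) by ring.
  rewrite Rabs_inv, Rabs_mult, (Rabs_pos_eq (_ + _)) by lra.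
  rewrite !Rinv_mult, <- !Rmult_assoc.
  apply Rmult_le_compat_r.
  { apply Rlt_le, Rinv_0_lt_compat, Rabs_pos_lt, I4. }
  assert (I5 : / (INR (S k) + INR (S n)) <= / INR (S k))
    by (apply Rinv_le_contravar; lra).
  assert (I6 : / (INR (S k) + INR (S n)) <= / INR (S n))
    by (apply Rinv_le_contravar; lra).
  assert (I7 : 0 < / (INR (S k) + INR (S n)))
    by (apply Rinv_0_lt_compat; lra).
  pose proof (inv_INR_S_bounds n) as I8. pose proof (inv_INR_S_bounds k) as I9.
  destruct p as [|p].
  - destruct q as [|q]; [lia |].
    pose proof (pow_inv_INR_S_le_1 q k) as J.
    rewrite pow_O, Rmult_1_l, <- tech_pow_Rmult.
    rewrite (Rmult_comm (/ INR (S n)) (/ INR (S k))).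
    apply Rmult_le_compat; nra.
  - pose proof (pow_inv_INR_S_le_1 q k) as J.
    pose proof (pow_inv_INR_S_le_1 p n) as J'. rewrite <- tech_pow_Rmult.
    apply Rmult_le_compat; [| lra | | lra].
    + apply Rmult_le_pos; nra.
    + rewrite Rmult_assoc.
      assert (J2 : (/ INR (S n)) ^ p * (/ INR (S k)) ^ q <= 1) by nra. nra.
Qed.

Lemma ex_series_double_term (p q n : nat) :
  (1 <= p + q)%nat -> ex_series (double_term p q n).
Proof.
  intros Hpq. eapply ex_series_bound.
  - intros k. apply double_term_bound, Hpq.
  - eexists. apply is_series_Rscal, is_series_majorant.
Qed.

(** These are the row sums of the bound in [double_term_bound]; by [H n <= H (S n)] they are at most
    3 times the terms of [ex_series_H_sq]. *)
Lemma ex_series_row_bound :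
  ex_series (fun n => H (S n) * ((2 * H n + H (S n)) / INR (S n) ^ 2)).
Proof.
  apply ex_series_H_sq_bound with 3. intros n.
  pose proof (H_nonneg n) as I1. pose proof (H_nonneg (S n)) as I2.
  assert (I3 : H n <= H (S n))
    by (rewrite H_S; pose proof (inv_INR_S_bounds n); lra).
  pose proof (pow_lt _ 2 (Rinv_0_lt_compat _ (INR_S_pos n))) as I4.
  unfold Rdiv. rewrite <- pow_inv.
  rewrite Rabs_pos_eq by (apply Rmult_le_pos; nra).
  rewrite <- !Rmult_assoc. apply Rmult_le_compat_r; nra.
Qed.

Definition double_sum (p q : nat) : R :=
  Series (fun n => Series (double_term p q n)).

Lemma is_series_double_sum_swap (p q : nat) : (1 <= p + q)%nat ->
  is_series (fun k => Series (fun n => double_term p q n k)) (double_sum p q).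
Proof.
  intros Hpq. eapply is_series_swap.
  - intros n k. apply double_term_bound, Hpq.
  - intros n. apply is_series_Rscal, is_series_majorant.
  - apply ex_series_row_bound.
Qed.

(** [Series] has a value even without convergence, so convergence of the outer sum over [n] is
    proved here, from the row sums of the majorant. *)
Lemma is_series_double_sum (p q : nat) : (1 <= p + q)%nat ->
  is_series (fun n => Series (double_term p q n)) (double_sum p q).
Proof.
  intros Hpq. apply Series_correct.
  apply ex_series_bound with (2 := ex_series_row_bound). intros n.
  assert (E : ex_series (fun k => Rabs (double_term p q n k))).
  { eapply ex_series_bound.
    - intros k. rewrite Rabs_Rabsolu. apply double_term_bound, Hpq.
    - eexists. apply is_series_Rscal, is_series_majorant. }
  eapply Rle_trans; [apply Series_Rabs, E |].
  rewrite <- (is_series_unique _ _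
    (is_series_Rscal (H (S n)) _ _ (is_series_majorant n))).
  apply Series_le.
  - intros k. split; [apply Rabs_pos | apply double_term_bound, Hpq].
  - eexists. apply is_series_Rscal, is_series_majorant.
Qed.

(** * The theorem *)

Lemma ex_series_H_sq_dominated (u : nat -> R) (s : nat) (c : nat -> R) :
  (2 <= s)%nat -> (forall j, Rabs (c j) <= H (S j) ^ 2) ->
  (forall j, u j = c j / INR (S j) ^ s) -> ex_series u.
Proof.
  intros Hs Hc Hu. apply ex_series_H_sq_bound with 1. intros j.
  replace s with (2 + (s - 2))%nat in Hu by lia.
  rewrite Hu. unfold Rdiv. rewrite Rabs_mult, Rmult_1_l, <- !pow_inv, pow_add.
  pose proof (pow_inv_INR_S_le_1 (s - 2) j) as I1.
  pose proof (pow_inv_INR_S_le_1 2 j) as I2.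
  apply Rmult_le_compat; [apply Rabs_pos | apply Rabs_pos | apply Hc |].
  rewrite Rabs_pos_eq; nra.
Qed.

Lemma zeta_star_trunc_1 (n : nat) : zeta_star_trunc [Plain 1] n = H n.
Proof.
  apply sum_n_m_ext. intros i. simpl. rewrite !Rmult_1_r. apply Rmult_1_l.
Qed.

Lemma zeta_star_trunc_2 (n : nat) : zeta_star_trunc [Plain 2] n = H2 n.
Proof.
  apply sum_n_m_ext. intros i. simpl. rewrite !Rmult_1_r. apply Rmult_1_l.
Qed.

Lemma is_series_zeta_star_plain_1 (s : nat) : (2 <= s)%nat ->
  is_series (fun j => H (S j) / INR (S j) ^ s) (zeta_star [Plain s; Plain 1]).
Proof.
  intros Hs. refine (is_series_eq
    (fun j => index_term (Plain s) (S j) * zeta_star_trunc [Plain 1] (S j))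
    _ _ _ _ eq_refl _).
  - intros j. rewrite zeta_star_trunc_1. unfold index_term, Rdiv. ring.
  - apply Series_correct, ex_series_H_sq_dominated with s (fun j => H (S j));
      [exact Hs | |].
    + intros j. pose proof (H_ge_1 j) as I1. rewrite Rabs_pos_eq; nra.
    + intros j. rewrite zeta_star_trunc_1. unfold index_term, Rdiv. ring.
Qed.

Lemma is_series_zeta_star_bar_1 (s : nat) : (2 <= s)%nat ->
  is_series (fun j => (-1) ^ S j * (H (S j) / INR (S j) ^ s))
    (zeta_star [Bar s; Plain 1]).
Proof.
  intros Hs. refine (is_series_eq
    (fun j => index_term (Bar s) (S j) * zeta_star_trunc [Plain 1] (S j))
    _ _ _ _ eq_refl _).
  - intros j. rewrite zeta_star_trunc_1. unfold index_term, Rdiv. ring.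
  - apply Series_correct, ex_series_H_sq_dominated with s
      (fun j => (-1) ^ S j * H (S j)); [exact Hs | |].
    + intros j. pose proof (H_ge_1 j) as I1.
      rewrite Rabs_mult, pow_1_abs, Rabs_pos_eq; nra.
    + intros j. rewrite zeta_star_trunc_1. unfold index_term, Rdiv. ring.
Qed.

Lemma is_series_zeta_star_bar_2 (s : nat) : (2 <= s)%nat ->
  is_series (fun j => (-1) ^ S j * (H2 (S j) / INR (S j) ^ s))
    (zeta_star [Bar s; Plain 2]).
Proof.
  intros Hs. refine (is_series_eq
    (fun j => index_term (Bar s) (S j) * zeta_star_trunc [Plain 2] (S j))
    _ _ _ _ eq_refl _).
  - intros j. rewrite zeta_star_trunc_2. unfold index_term, Rdiv. ring.
  - apply Series_correct, ex_series_H_sq_dominated with s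
      (fun j => (-1) ^ S j * H2 (S j)); [exact Hs | |].
    + intros j. pose proof (H_ge_1 j) as I1. pose proof (H2_bounds (S j)) as I2.
      rewrite Rabs_mult, pow_1_abs, Rabs_pos_eq; nra.
    + intros j. rewrite zeta_star_trunc_2. unfold index_term, Rdiv. ring.
Qed.

Lemma is_series_zeta_bar (s : nat) : (2 <= s)%nat ->
  is_series (fun j => (-1) ^ j / INR (S j) ^ s) (zeta_bar s).
Proof.
  intros Hs. apply Series_correct.
  apply ex_series_H_sq_dominated with s (fun j => (-1) ^ j); try easy.
  intros j. pose proof (H_ge_1 j) as I1. rewrite pow_1_abs. nra.
Qed.

(** * Relations between the double sums, and their evaluations *)

Lemma double_term_step (p q n k : nat) :
  double_term (S (S p)) q n k - double_term p (S (S q)) n k =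
  H (S n) / INR (S n) ^ S (S p)
  * (if Nat.eqb k n then 0 else (-1) ^ k / INR (S k) ^ S (S q)).
Proof.
  unfold double_term, kernel. simpl Nat.eqb. replace (S k - 1)%nat with k by lia.
  destruct (Nat.eqb_spec k n) as [|E]; [ring |].
  pose proof (INR_S_pos n) as I1. pose proof (INR_S_pos k) as I2.
  pose proof (INR_S_minus_neq_0 n k E) as I3.
  pose proof (pow_lt _ p I1) as I4. pose proof (pow_lt _ q I2) as I5.
  rewrite <- !tech_pow_Rmult. field. repeat split; try lra.
  intros C. apply (INR_S_sq_minus_neq_0 n k E). rewrite <- C. ring.
Qed.

(** Each row of the difference is [H (S n) / INR (S n) ^ S (S p)] times [zeta_bar (S (S q))] without
    its diagonal term. On the diagonal the exponents p + 2 and q + 2 add up, and the minus sign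
    makes the sign that of a barred argument. *)
Lemma double_sum_step (p q : nat) : (1 <= p + q)%nat ->
  double_sum (S (S p)) q = double_sum p (S (S q))
    + zeta_star [Plain (S (S p)); Plain 1] * zeta_bar (S (S q))
    + zeta_star [Bar (p + q + 4); Plain 1].
Proof.
  intros Hpq.
  pose proof (is_series_Rminus _ _ _ _
    (is_series_double_sum (S (S p)) q ltac:(lia))
    (is_series_double_sum p (S (S q)) ltac:(lia)))
    as E1.
  pose proof (is_series_Rplus _ _ _ _
    (is_series_Rscal (zeta_bar (S (S q))) _ _
      (is_series_zeta_star_plain_1 (S (S p)) ltac:(lia)))
    (is_series_zeta_star_bar_1 (p + q + 4) ltac:(lia))) as E2.
  apply is_series_unique in E1. apply is_series_unique in E2.
  rewrite (Series_ext _ (fun n => zeta_bar (S (S q)) *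
    (H (S n) / INR (S n) ^ S (S p))
    + (-1) ^ S n * (H (S n) / INR (S n) ^ (p + q + 4)))) in E1; [lra |].
  intros n.
  rewrite <- (Series_minus (double_term (S (S p)) q n) (double_term p (S (S q)) n))
    by (apply ex_series_double_term; lia).
  rewrite (Series_ext _ _ (double_term_step p q n)), Series_scal_l.
  rewrite (is_series_unique
    (fun k => if Nat.eqb k n then 0 else (-1) ^ k / INR (S k) ^ S (S q)) _
    (is_series_off_diag _ n _ (is_series_zeta_bar (S (S q)) ltac:(lia)))).
  replace (p + q + 4)%nat with (S (S p) + S (S q))%nat by lia.
  rewrite pow_add.
  pose proof (pow_lt _ (S (S p)) (INR_S_pos n)) as I1.
  pose proof (pow_lt _ (S (S q)) (INR_S_pos n)) as I2.
  rewrite <- (tech_pow_Rmult (-1) n). field. lra.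
Qed.

(** Every step preserves the sum of the two exponents, so all [r] diagonal corrections are equal. *)
Lemma double_sum_iter (p q r : nat) : (1 <= p + q)%nat ->
  double_sum (p + 2 * r) q = double_sum p (q + 2 * r)
    + sum_n_m (fun i => zeta_star [Plain (p + 2 * i); Plain 1]
                        * zeta_bar (q + 2 * r + 2 - 2 * i)) 1 r
    + INR r * zeta_star [Bar (p + q + 2 * r + 2); Plain 1].
Proof.
  (* Each step raises [q] by two, so the induction hypothesis must hold for all [q]. *)
  revert q. induction r as [|r IH]; intros q Hpq.
  - rewrite sum_1_0, !Nat.mul_0_r, !Nat.add_0_r. simpl INR. ring.
  - replace (p + 2 * S r)%nat with (S (S (p + 2 * r))) by lia.
    rewrite double_sum_step, IH, sum_1_S, (S_INR r) by lia.
    rewrite (sum_1_ext (fun i => _ * zeta_bar (q + 2 * S r + 2 - 2 * i))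
      (fun i => zeta_star [Plain (p + 2 * i); Plain 1]
                * zeta_bar (S (S q) + 2 * r + 2 - 2 * i)))
      by (intros i Hi; do 2 f_equal; lia).
    replace (p + 2 * S r)%nat with (S (S (p + 2 * r))) by lia.
    replace (q + 2 * S r + 2 - 2 * S r)%nat with (S (S q)) by lia.
    replace (q + 2 * S r)%nat with (S (S q) + 2 * r)%nat by lia.
    replace (p + S (S q) + 2 * r + 2)%nat with (p + q + 2 * S r + 2)%nat by lia.
    replace (p + 2 * r + q + 4)%nat with (p + q + 2 * S r + 2)%nat by lia.
    ring.
Qed.

Lemma Series_double_term_row (p q n : nat) :
  Series (double_term p q n) = H (S n) / INR (S n) ^ p *
    Series (fun k => (-1) ^ (S k - 1) / INR (S k) ^ q * kernel (S n) (S k)).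
Proof. apply Series_scal_l. Qed.

(** The minus sign is the antisymmetry of [kernel], whose first argument becomes the fixed index. *)
Lemma Series_double_term_col (p q k : nat) :
  Series (fun n => double_term p q n k) = - (-1) ^ k / INR (S k) ^ q *
    Series (fun n => H (S n) / INR (S n) ^ p * kernel (S k) (S n)).
Proof.
  rewrite <- Series_scal_l. apply Series_ext. intros n. unfold double_term.
  rewrite (kernel_antisym (S k) (S n)). replace (S k - 1)%nat with k by lia.
  unfold Rdiv. ring.
Qed.

(** With [q = 0] the sum over [k] is [is_series_alt_kernel], so no product of [H] and [L]
    appears. *)
Lemma double_sum_odd_0 (r : nat) :
  double_sum (1 + 2 * r) 0 = - / 2 * zeta_star [Plain (2 * r + 3); Plain 1]
    - / 4 * zeta_star [Bar (2 * r + 3); Plain 1].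
Proof.
  pose proof (is_series_double_sum (1 + 2 * r) 0 ltac:(lia)) as E1.
  pose proof (is_series_Rminus _ _ _ _
    (is_series_Rscal (- / 2) _ _
      (is_series_zeta_star_plain_1 (2 * r + 3) ltac:(lia)))
    (is_series_Rscal (/ 4) _ _
      (is_series_zeta_star_bar_1 (2 * r + 3) ltac:(lia)))) as E2.
  rewrite <- (is_series_unique _ _ E1), <- (is_series_unique _ _ E2).
  apply Series_ext. intros n. rewrite Series_double_term_row.
  rewrite (Series_ext _ (fun k => (-1) ^ (S k - 1) * kernel (S n) (S k)))
    by (intros k; rewrite pow_O, Rdiv_1_r; reflexivity).
  rewrite (is_series_unique _ _ (is_series_alt_kernel n)).
  replace (2 * r + 3)%nat with (2 + (1 + 2 * r))%nat by lia.
  rewrite (pow_add _ 2).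
  pose proof (INR_S_pos n) as I1. pose proof (pow_lt _ (1 + 2 * r) I1) as I2.
  field. lra.
Qed.

(** With [p = 1] the sum over [n], taken first, is [is_series_H_div_kernel]; this is the source of
    [H ^ 2]. *)
Lemma is_series_double_sum_1_even (r : nat) :
  is_series (fun k => - (-1) ^ k *
      (H2 (S k) - H (S k) ^ 2 + 5 * H (S k) / (2 * INR (S k)) - zeta 2)
      / (2 * INR (S k) ^ (2 * r + 2))) (double_sum 1 (2 * r)).
Proof.
  refine (is_series_eq _ _ _ _ _ eq_refl
    (is_series_double_sum_swap 1 (2 * r) ltac:(lia))).
  intros k. rewrite Series_double_term_col.
  rewrite (Series_ext _ (fun n => H (S n) / INR (S n) * kernel (S k) (S n)))
    by (intros n; rewrite pow_1; reflexivity).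
  rewrite (is_series_unique _ _ (is_series_H_div_kernel k)).
  rewrite (pow_add _ (2 * r) 2).
  pose proof (INR_S_pos k) as I1. pose proof (pow_lt _ (2 * r) I1) as I2.
  field. lra.
Qed.

(** With [p = 0] the sum over [n], taken first, is [is_series_H_kernel], where only [H2], [zeta 2]
    and [H] occur. *)
Lemma double_sum_0_odd (r : nat) :
  double_sum 0 (1 + 2 * r) = zeta_star [Bar (2 * r + 2); Plain 2]
    - / 2 * zeta 2 * zeta_bar (2 * r + 2)
    - / 4 * zeta_star [Bar (2 * r + 3); Plain 1].
Proof.
  pose proof (is_series_double_sum_swap 0 (1 + 2 * r) ltac:(lia)) as E1.
  pose proof (is_series_Rminus _ _ _ _
    (is_series_Rminus _ _ _ _
      (is_series_zeta_star_bar_2 (2 * r + 2) ltac:(lia))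
      (is_series_Rscal (/ 2 * zeta 2) _ _
        (is_series_zeta_bar (2 * r + 2) ltac:(lia))))
    (is_series_Rscal (/ 4) _ _
      (is_series_zeta_star_bar_1 (2 * r + 3) ltac:(lia)))) as E2.
  rewrite <- (is_series_unique _ _ E1), <- (is_series_unique _ _ E2).
  apply Series_ext. intros k. rewrite Series_double_term_col.
  rewrite (Series_ext _ (fun n => H (S n) * kernel (S k) (S n)))
    by (intros n; rewrite pow_O, Rdiv_1_r; reflexivity).
  rewrite (is_series_unique _ _ (is_series_H_kernel k)).
  replace (2 * r + 3)%nat with (2 + (1 + 2 * r))%nat by lia.
  replace (2 * r + 2)%nat with (1 + (1 + 2 * r))%nat by lia.
  rewrite (pow_add _ 2 (1 + _)), (pow_add _ 1 (1 + _)), <- (tech_pow_Rmult (-1) k).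
  pose proof (INR_S_pos k) as I1. pose proof (pow_lt _ (1 + 2 * r) I1) as I2.
  field. lra.
Qed.

(** With [q = 1] the sum over [k] is [is_series_alt_div_kernel]; this is the source of the product
    of [H] and [L 1]. *)
Lemma is_series_double_sum_even_1 (r : nat) :
  is_series (fun n => H (S n) *
      (2 * (-1) ^ S n * (ln 2 - L 1 (S n)) - 2 * ln 2 - / INR (S n)
       - 3 / 2 * (-1) ^ S n / INR (S n)) / (2 * INR (S n) ^ (2 * r + 2)))
    (double_sum (2 * r) 1).
Proof.
  refine (is_series_eq _ _ _ _ _ eq_refl
    (is_series_double_sum (2 * r) 1 ltac:(lia))).
  intros n. rewrite Series_double_term_row.
  rewrite (Series_ext _ (fun k => (-1) ^ (S k - 1) / INR (S k) * kernel (S n) (S k)))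
    by (intros k; rewrite pow_1; reflexivity).
  rewrite (is_series_unique _ _ (is_series_alt_div_kernel n)).
  rewrite (pow_add _ (2 * r) 2).
  pose proof (INR_S_pos n) as I1. pose proof (pow_lt _ (2 * r) I1) as I2.
  field. lra.
Qed.

Theorem theorem3p1 : forall m : nat, (1 <= m)%nat ->
  is_series (fun j : nat => let n := S j in
      H n ^ 2 / INR n ^ (2 * m) * (-1) ^ (n - 1))
    (- zeta_star [Bar (2 * m); Plain 2]
     - (2 * INR m + 1) * zeta_star [Bar (2 * m + 1); Plain 1]
     - zeta_star [Plain (2 * m + 1); Plain 1]
     - zeta 2 * zeta_bar (2 * m)
     - 2 * sum_n_m (fun l : nat =>
             zeta_star [Plain (2 * l - 1); Plain 1]
             * zeta_bar (2 * m + 2 - 2 * l)) 2 m)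
  /\
  is_series (fun j : nat => let n := S j in
      H n * L 1 n / INR n ^ (2 * m) * (-1) ^ (n - 1))
    (sum_n_m (fun l : nat =>
        zeta_star [Plain (2 * l); Plain 1]
        * zeta_bar (2 * m + 1 - 2 * l)) 1 (m - 1)
     - ln 2 * zeta_star [Bar (2 * m); Plain 1]
     + ln 2 * zeta_star [Plain (2 * m); Plain 1]
     + 1 / 2 * zeta_star [Plain (2 * m + 1); Plain 1]
     + zeta_star [Bar (2 * m); Plain 2]
     + (2 * INR m - 1) / 2 * zeta_star [Bar (2 * m + 1); Plain 1]
     - 1 / 2 * zeta 2 * zeta_bar (2 * m)).
Proof.
  intros [|r] Hm; [lia |]. clear Hm.
  replace (2 * S r)%nat with (2 * r + 2)%nat by lia.
  replace (2 * r + 2 + 1)%nat with (2 * r + 3)%nat by lia.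
  replace (S r - 1)%nat with r by lia.
  pose proof (is_series_zeta_star_bar_2 (2 * r + 2) ltac:(lia)) as D2.
  pose proof (is_series_zeta_star_bar_1 (2 * r + 3) ltac:(lia)) as D1.
  pose proof (is_series_zeta_bar (2 * r + 2) ltac:(lia)) as D0.
  assert (P3 : forall x, x ^ (2 * r + 3) = x * x ^ (2 * r + 2)).
  { intros x. replace (2 * r + 3)%nat with (S (2 * r + 2)) by lia. reflexivity. }
  split; cbv zeta.
  (* With [l = i + 1] the range from 2 to [m] becomes the range from 1 to [r] of
     [double_sum_iter]. *)
  - rewrite <- (sum_n_m_S (fun l => _ * _)).
    (* [is_series_double_sum_1_even] is doubled and solved for the term with [H ^ 2]; [D2] and [D1]
       carry the sign [(-1) ^ n], hence are subtracted. *)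
    refine (is_series_eq _ _ _ _ _ _
      (is_series_Rminus _ _ _ _
        (is_series_Rminus _ _ _ _
          (is_series_Rminus _ _ _ _
            (is_series_Rscal 2 _ _ (is_series_double_sum_1_even r)) D2)
          (is_series_Rscal (5 / 2) _ _ D1))
        (is_series_Rscal (zeta 2) _ _ D0))).
    + intros j. replace (S j - 1)%nat with j by lia.
      rewrite P3, <- (tech_pow_Rmult (-1) j).
      pose proof (INR_S_pos j) as I1. pose proof (pow_lt _ (2 * r + 2) I1) as I2.
      field. lra.
    (* The coefficient of the barred value of weight 2m + 2 is 2(-1/4 - r) - 5/2 = -(2m + 1), with m
       = r + 1. *)
    + pose proof (double_sum_iter 1 0 r ltac:(lia)) as E.
      rewrite double_sum_odd_0 in E.
      change (0 + 2 * r)%nat with (2 * r)%nat in E.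
      replace (1 + 0 + 2 * r + 2)%nat with (2 * r + 3)%nat in E by lia.
      rewrite (sum_1_ext _ (fun i => zeta_star [Plain (1 + 2 * i); Plain 1]
                        * zeta_bar (2 * r + 2 - 2 * i)))
        by (intros i Hi; f_equal; [do 3 f_equal | f_equal]; lia).
      rewrite S_INR. lra.
  (* [is_series_double_sum_even_1] is solved for the term with the product of [H] and [L 1]. *)
  - refine (is_series_eq _ _ _ _ _ _
      (is_series_Rplus _ _ _ _
        (is_series_Rplus _ _ _ _
          (is_series_Rplus _ _ _ _
            (is_series_Rminus _ _ _ _ (is_series_double_sum_even_1 r)
              (is_series_Rscal (ln 2) _ _
                (is_series_zeta_star_bar_1 (2 * r + 2) ltac:(lia))))
            (is_series_Rscal (ln 2) _ _
              (is_series_zeta_star_plain_1 (2 * r + 2) ltac:(lia))))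
          (is_series_Rscal (/ 2) _ _
            (is_series_zeta_star_plain_1 (2 * r + 3) ltac:(lia))))
        (is_series_Rscal (3 / 4) _ _ D1))).
    + intros j. replace (S j - 1)%nat with j by lia.
      rewrite P3, <- (tech_pow_Rmult (-1) j).
      pose proof (INR_S_pos j) as I1. pose proof (pow_lt _ (2 * r + 2) I1) as I2.
      field. lra.
    (* Here the coefficient of the same barred value is -1/4 + r + 3/4 = (2m - 1)/2. *)
    + pose proof (double_sum_iter 0 1 r ltac:(lia)) as E.
      rewrite double_sum_0_odd in E.
      change (0 + 2 * r)%nat with (2 * r)%nat in E.
      replace (0 + 1 + 2 * r + 2)%nat with (2 * r + 3)%nat in E by lia.
      rewrite E, S_INR.
      rewrite (sum_1_ext
        (fun i => zeta_star [Plain (0 + 2 * i); Plain 1] * _)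
        (fun l => zeta_star [Plain (2 * l); Plain 1]
                        * zeta_bar (2 * r + 3 - 2 * l)))
        by (intros i Hi; f_equal; f_equal; lia).
      field.
Qed.
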